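(* Suppose each $f_i$ is $\mu$-strongly convex and $L$-smooth with $\mu>0$, and that $W$ is a weight matrix as described in the context. Let $v^0\in\mathrm{Span}(U^2)$ (i.e. every column of $v^0\in\mathbb{R}^{m\times n}$ lies in the column space of $U^2$), let $\beta=L$ and $\alpha=\frac{1}{2(L+\beta)}$, and let $(x^k,v^k)_{k\ge 0}$ be generated by EXTRA from an arbitrary $x^0\in\mathbb{R}^{m\times n}$ and $v^0$. Let $\lambda^k\in\mathbb{R}^{m\times n}$ be the matrix with columns in $\mathrm{Span}(U)$ such that $U\lambda^k=v^k$, and define $$\rho_k=(L+\beta)\|x^k-x^*\|_F^2+\frac{1}{2\beta}\|\lambda^k-\lambda^*\|_F^2 .$$ Then for all $k\ge 0$ $$\rho_{k+1}\le(1-\delta)\rho_k,\qquad \delta=\frac{1}{39\left(\frac{L}{\mu}+\frac{1}{1-\sigma_2(W)}\right)} .$$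
   Context: Setting: $m$ agents form an undirected network; $f_1,\dots,f_m:\mathbb{R}^n\to\mathbb{R}$ are differentiable, and $F(x)=\frac1m\sum_{i=1}^m f_i(x)$. $f_i$ is $\mu$-strongly convex if $f_i(y)\ge f_i(x)+\langle\nabla f_i(x),y-x\rangle+\frac{\mu}{2}\|y-x\|^2$ for all $x,y$, and $L$-smooth if $f_i(y)\le f_i(x)+\langle\nabla f_i(x),y-x\rangle+\frac{L}{2}\|y-x\|^2$ for all $x,y$. For $x\in\mathbb{R}^{m\times n}$ with rows $x_{(1)}^T,\dots,x_{(m)}^T$, put $f(x)=\sum_{i=1}^m f_i(x_{(i)})$, and let $\nabla f(x)\in\mathbb{R}^{m\times n}$ have rows $\nabla f_i(x_{(i)})^T$. Weight matrix: $W\in\mathbb{R}^{m\times m}$ with $W_{i,j}\ne0$ if and only if agents $i,j$ are neighbors or $i=j$; $W=W^T$, $I\succeq W\succeq -I$, $W\mathbf{1}=\mathbf{1}$; and $\sigma_2(W)<1$, where $\sigma_2(W)$ is the second largest singular value of $W$. $U=\sqrt{(I-W)/2}$ (positive semidefinite square root). $\mathrm{Span}(\cdot)$ denotes the column space; a matrix is said to lie in it if all its columns do. EXTRA with parameters $\alpha,\beta>0$ and input $x^0,v^0\in\mathbb{R}^{m\times n}$ iterates $$x^{k+1}=x^k-\alpha\left(\nabla f(x^k)+v^k+\tfrac{\beta}{2}(I-W)x^k\right),\qquad v^{k+1}=v^k+\tfrac{\beta}{2}(I-W)x^{k+1}.$$ If $v^0\in\mathrm{Span}(U^2)$ then $v^k=U\lambda^k$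 with $\lambda^k\in\mathrm{Span}(U)$ and $\lambda^{k+1}=\lambda^k+\beta Ux^{k+1}$. $x^*\in\mathbb{R}^{m\times n}$ also denotes the matrix $\mathbf{1}(x^* )^T$, all of whose rows equal the minimizer of $F$; $\lambda^*\in\mathrm{Span}(U)$ is such that $(x^*,\lambda^* )$ is a KKT point of $\min_x\max_\lambda f(x)+\langle\lambda,Ux\rangle$, i.e. $\nabla f(x^* )+U\lambda^*=0$ and $Ux^*=0$. *)

(* Defs.v *)
From mathcomp Require Import all_boot all_order all_algebra.
From mathcomp Require Import polyrcf.
From mathcomp Require Import boolp classical_sets reals topology normedtype derive.

Set Implicit Arguments.
Unset Strict Implicit.
Unset Printing Implicit Defensive.

Import Order.TTheory GRing.Theory Num.Theory.
Import numFieldNormedType.Exports.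
Local Open Scope ring_scope.

(* The library norm `|_| on matrices is the sup norm; the Euclidean structure is
   therefore introduced here.  On row vectors (m = 1) inner and fnorm are the
   usual inner product and Euclidean norm of R^n. *)
Definition inner (R : realType) (m n : nat) (A B : 'M[R]_(m, n)) : R :=
  \sum_(i < m) \sum_(j < n) A i j * B i j.

Definition fnorm (R : realType) (m n : nat) (A : 'M[R]_(m, n)) : R :=
  Num.sqrt (inner A A).

Definition grad (R : realType) (n : nat) (g : 'rV[R]_n -> R) (x : 'rV[R]_n) :
    'rV[R]_n :=
  \row_(j < n) 'D_(delta_mx 0 j) g x.

Definition strongly_convex (R : realType) (n : nat) (mu : R)
    (g : 'rV[R]_n -> R) : Prop :=
  forall x y : 'rV[R]_n,
    g y >= g x + inner (grad g x) (y - x) + mu / 2 * fnorm (y - x) ^+ 2.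

Definition smooth (R : realType) (n : nat) (L : R)
    (g : 'rV[R]_n -> R) : Prop :=
  forall x y : 'rV[R]_n,
    g y <= g x + inner (grad g x) (y - x) + L / 2 * fnorm (y - x) ^+ 2.

Definition average (R : realType) (m n : nat) (f : 'I_m -> 'rV[R]_n -> R)
    (x : 'rV[R]_n) : R :=
  m%:R^-1 * \sum_(i < m) f i x.

Definition is_minimizer (R : realType) (n : nat) (g : 'rV[R]_n -> R)
    (x : 'rV[R]_n) : Prop :=
  forall y : 'rV[R]_n, g x <= g y.

Definition stacked_grad (R : realType) (m n : nat) (f : 'I_m -> 'rV[R]_n -> R)
    (x : 'M[R]_(m, n)) : 'M[R]_(m, n) :=
  \matrix_(i < m) grad (f i) (row i x).

Definition consensus (R : realType) (m n : nat) (x : 'rV[R]_n) : 'M[R]_(m, n) :=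
  (const_mx 1 : 'cV[R]_m) *m x.

Definition psd (R : realType) (m : nat) (A : 'M[R]_m) : Prop :=
  A^T = A /\ forall u : 'cV[R]_m, 0 <= (u^T *m A *m u) 0 0.

Definition loewner_le (R : realType) (m : nat) (A B : 'M[R]_m) : Prop :=
  psd (B - A).

Definition is_psd_sqrt (R : realType) (m : nat) (U A : 'M[R]_m) : Prop :=
  psd U /\ U *m U = A.

(* (_ <= _)%MS compares row spaces, whence the transpositions. *)
Definition in_span (R : realType) (m p q : nat) (X : 'M[R]_(m, p))
    (A : 'M[R]_(m, q)) : Prop :=
  (X^T <= A^T)%MS.

(* Square roots of the roots of char_poly (A^T *m A), repeated according to
   algebraic multiplicity.  rootsR is increasing, so the list is nonincreasing
   after rev. *)
Definition singular_values (R : realType) (m : nat) (A : 'M[R]_m) : seq R :=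
  let p := char_poly (A^T *m A) in
  rev (flatten [seq nseq (mup a p) (Num.sqrt a) | a <- rootsR p]).

(* Equals 0 by convention when m <= 1, where there is no second value. *)
Definition sigma2 (R : realType) (m : nat) (A : 'M[R]_m) : R :=
  (singular_values A)`_1.

Record weight_matrix (R : realType) (m : nat) (neighbor : rel 'I_m)
    (W : 'M[R]_m) : Prop := WeightMatrix {
  weight_support : forall i j : 'I_m, W i j != 0 <-> neighbor i j \/ i = j;
  weight_sym : W = W^T;
  weight_le : loewner_le W 1%:M;
  weight_ge : loewner_le (- 1%:M) W;
  weight_one : W *m const_mx 1 = const_mx 1 :> 'cV[R]_m;
  weight_sigma2 : sigma2 W < 1
}.

Definition extra_iterates (R : realType) (m n : nat)
    (f : 'I_m -> 'rV[R]_n -> R) (W : 'M[R]_m) (alpha beta : R)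
    (x v : nat -> 'M[R]_(m, n)) : Prop :=
  forall k : nat,
    x k.+1 = x k - alpha *: (stacked_grad f (x k) + v k
                             + (beta / 2) *: ((1%:M - W) *m x k)) /\
    v k.+1 = v k + (beta / 2) *: ((1%:M - W) *m x k.+1).

(* KKT point of the saddle problem min_x max_lambda f(x) + <lambda, U x>. *)
Definition is_kkt (R : realType) (m n : nat) (f : 'I_m -> 'rV[R]_n -> R)
    (U : 'M[R]_m) (x lambda : 'M[R]_(m, n)) : Prop :=
  stacked_grad f x + U *m lambda = 0 /\ U *m x = 0.

(* Main.v *)
(* Write e = x^k - x*, d = x^{k+1} - x^k, l = lambda^k - lambda*, and let h be the
   difference of the gradients at x^k and x*.  The primal update and the dual update
   lambda^{k+1} = lambda^k + L U x^{k+1} give exactly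
     rho_{k+1} - rho_k = - <h, e + d> - 2 L |d|^2 + L/2 |U d|^2 - L/2 |U e|^2.
   Since |U d| <= |d|, and since strong convexity, smoothness and cocoercivity give
   <h, e + d> >= mu/4 |e|^2 + 1/(4L) |h|^2 - L/2 |d|^2, the decrease is at least
     mu/4 |e|^2 + 1/(4L) |h|^2 + L |d|^2 + L/2 |U e|^2.
   The first term pays for delta * 2 L |e|^2.  The others pay for the dual part:
   U l = - 4 L d - h - L U^2 e by the primal update, and
   (1 - sigma_2) |l|^2 <= 2 |U l|^2 because l is in the span of U, hence orthogonal
   to the vector 1.  The last bound comes from diagonalizing W over R[i]: both 1 and
   d_i^2 are roots, with multiplicity, of the characteristic polynomial of W^T W, so
   every eigenvalue d_i of W other than the one of the vector 1 satisfies
   |d_i| <= sigma_2. *)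

Require Import Defs.
From mathcomp Require Import all_boot all_order all_algebra.
From mathcomp Require Import boolp classical_sets reals topology normedtype derive.
From mathcomp Require Import complex polyrcf spectral sesquilinear ring lra.
Import Order.TTheory GRing.Theory Num.Theory.
Import numFieldNormedType.Exports.
Local Open Scope ring_scope.

(** * Frobenius inner product of matrices *)

Section Inner.
Context {R : realType} {m n : nat}.
Implicit Types A B C : 'M[R]_(m, n).

Lemma innerC A B : inner A B = inner B A.
Proof. by apply: eq_bigr => i _; apply: eq_bigr => j _; rewrite mulrC. Qed.

Lemma innerDl A B C : inner (A + B) C = inner A C + inner B C.
Proof.
rewrite /inner -big_split; apply: eq_bigr => i _ /=.
by rewrite -big_split; apply: eq_bigr => j _ /=; rewrite mxE mulrDl.
Qed.

Lemma innerZl a A B : inner (a *: A) B = a * inner A B.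
Proof.
rewrite /inner mulr_sumr; apply: eq_bigr => i _; rewrite mulr_sumr.
by apply: eq_bigr => j _; rewrite mxE mulrA.
Qed.

Lemma innerNl A B : inner (- A) B = - inner A B.
Proof. by rewrite -scaleN1r innerZl mulN1r. Qed.

Lemma innerDr A B C : inner A (B + C) = inner A B + inner A C.
Proof. by rewrite innerC innerDl !(innerC A). Qed.

Lemma innerZr a A B : inner A (a *: B) = a * inner A B.
Proof. by rewrite innerC innerZl innerC. Qed.

Lemma innerNr A B : inner A (- B) = - inner A B.
Proof. by rewrite innerC innerNl innerC. Qed.

Lemma inner_ge0 A : 0 <= inner A A.
Proof. by apply: sumr_ge0 => i _; apply: sumr_ge0 => j _; rewrite -expr2 sqr_ge0. Qed.

Lemma inner_eq0 A : inner A A = 0 <-> A = 0.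
Proof.
split=> [|->]; last by rewrite -(scale0r 0) innerZl mul0r.
move=> A0; apply/matrixP => i j; rewrite mxE.
have sq_ge0 i' j' : 0 <= A i' j' * A i' j' by rewrite -expr2 sqr_ge0.
have row0 : \sum_j A i j * A i j = 0.
  by apply: psumr_eq0P A0 _ _ => // i' _; apply: sumr_ge0.
have : A i j * A i j = 0 by apply: psumr_eq0P row0 _ _.
by move/eqP; rewrite mulf_eq0 orbb => /eqP.
Qed.

Lemma fnorm_sqr A : fnorm A ^+ 2 = inner A A.
Proof. by rewrite sqr_sqrtr ?inner_ge0. Qed.

End Inner.

Definition innerE := (@innerDl, @innerDr, @innerNl, @innerNr, @innerZl, @innerZr).

Lemma inner_rows {R : realType} {m n : nat} (A B : 'M[R]_(m, n)) :
  inner A B = \sum_(i < m) inner (row i A) (row i B).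
Proof.
apply: eq_bigr => i _; rewrite /inner big_ord1.
by apply: eq_bigr => j _; rewrite !mxE.
Qed.

Lemma inner_cols {R : realType} {m n : nat} (A B : 'M[R]_(m, n)) :
  inner A B = \sum_(j < n) ((col j A)^T *m col j B) 0 0.
Proof.
rewrite /inner exchange_big; apply: eq_bigr => j _; rewrite mxE.
by apply: eq_bigr => i _; rewrite !mxE.
Qed.

Lemma inner_mulmxl {R : realType} {m p n : nat} (U : 'M[R]_(p, m))
    (A : 'M[R]_(m, n)) (B : 'M[R]_(p, n)) :
  inner (U *m A) B = inner A (U^T *m B).
Proof.
rewrite !inner_cols; apply: eq_bigr => j _.
by rewrite !colE !trmx_mul !mulmxA.
Qed.

Lemma inner_psd {R : realType} {m n : nat} (A : 'M[R]_m) (X : 'M[R]_(m, n)) :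
  psd A -> 0 <= inner X (A *m X).
Proof.
move=> [_ psdA]; rewrite inner_cols; apply: sumr_ge0 => j _.
by rewrite [col j (A *m X)]colE -mulmxA -colE mulmxA.
Qed.

(** Parallelogram law used twice, first to split [A] from [B + C], then [B] from [C]; hence the
    asymmetric weights. *)
Lemma inner_sum3_le {R : realType} {m n : nat} (A B C : 'M[R]_(m, n)) :
  inner (A + B + C) (A + B + C) <= 2 * inner A A + 4 * inner B B + 4 * inner C C.
Proof.
have h1 := inner_ge0 (A - B - C); have h2 := inner_ge0 (B - C).
move: h1 h2; rewrite !innerE (innerC B A) (innerC C A) (innerC C B); lra.
Qed.

(** * Gradient inequalities under strong convexity and smoothness *)

Section Gradient.
Context {R : realType} {m n : nat}.
Variables (F : 'M[R]_(m, n) -> R) (G : 'M[R]_(m, n) -> 'M[R]_(m, n)) (mu L : R).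
Hypotheses (mu_ge0 : 0 <= mu) (L_gt0 : 0 < L).
Hypothesis F_convex : forall x y,
  F y >= F x + inner (G x) (y - x) + mu / 2 * fnorm (y - x) ^+ 2.
Hypothesis F_smooth : forall x y,
  F y <= F x + inner (G x) (y - x) + L / 2 * fnorm (y - x) ^+ 2.

(* Compare both bounds at the gradient step y - (G y - G x) / L. *)
Lemma bregman_ge_grad (x y : 'M[R]_(m, n)) :
  F x + inner (G x) (y - x) + (2 * L)^-1 * fnorm (G y - G x) ^+ 2 <= F y.
Proof.
set h := G y - G x; pose z := y - L^-1 *: h.
have := F_convex x z; have := F_smooth y z.
have -> : z - y = - (L^-1 *: h) by rewrite /z addrC addKr.
have -> : z - x = (y - x) - L^-1 *: h by rewrite /z addrAC.
rewrite !fnorm_sqr.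
rewrite (innerDr (G x)) !innerNl !innerNr !innerZl !innerZr opprK.
have -> : inner h h = inner (G y) h - inner (G x) h by rewrite {1}/h innerDl innerNl.
set X := mu / 2 * inner _ _; have X0 : 0 <= X by rewrite mulr_ge0 ?inner_ge0 ?divr_ge0.
set a := inner (G y) h; set b := inner (G x) h; set c := inner (G x) _.
have -> : L / 2 * (L^-1 * (L^-1 * (a - b))) = (2 * L)^-1 * (a - b).
  by field; rewrite gt_eqF.
have -> : L^-1 * a = 2 * (2 * L)^-1 * a by field; rewrite gt_eqF.
have -> : L^-1 * b = 2 * (2 * L)^-1 * b by field; rewrite gt_eqF.
lra.
Qed.

(** Smoothness from [x] to [z] against strong convexity from [y] to [z] leaves [F y - F x]. This is
    bounded below by the average of strong convexity and the Bregman bound from [x] to [y], which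
    halves [mu / 2] and [(2 * L)^-1]. *)
Lemma grad_inner_ge (x y z : 'M[R]_(m, n)) :
  mu / 4 * fnorm (x - y) ^+ 2 + (4 * L)^-1 * fnorm (G x - G y) ^+ 2
    - L / 2 * fnorm (z - x) ^+ 2 <= inner (G x - G y) (z - y).
Proof.
have h1 := F_smooth x z; have h2 := F_convex y z.
have h3 := F_convex x y; have h4 := bregman_ge_grad x y.
have hz : 0 <= mu / 2 * fnorm (z - y) ^+ 2 by rewrite mulr_ge0 ?divr_ge0 ?sqr_ge0.
have sym (A B : 'M[R]_(m, n)) : fnorm (A - B) ^+ 2 = fnorm (B - A) ^+ 2.
  by rewrite !fnorm_sqr -(opprB B A) innerNl innerNr opprK.
rewrite (sym x y) (sym (G x)).
have -> : inner (G x - G y) (z - y) =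
    inner (G x) (z - x) - inner (G x) (y - x) - inner (G y) (z - y).
  by rewrite !innerE; ring.
have -> : (4 * L)^-1 = (2 * L)^-1 / 2 by field; rewrite gt_eqF.
lra.
Qed.

End Gradient.

(** * Decrease of the Lyapunov function over one step *)

Section Step.
Context {R : realType} {m n : nat}.
Variables (L : R) (U : 'M[R]_m) (e d l h : 'M[R]_(m, n)).
Hypotheses (L_gt0 : 0 < L) (Usym : U^T = U).
(* One EXTRA step with beta = L and alpha = 1 / (4 L), relative to the KKT point. *)
Hypothesis d_eq : d = - (4 * L)^-1 *: (h + U *m l + L *: (U *m (U *m e))).

Let gain := inner (U *m e) (U *m e).

Lemma lyapunov_identity :
  2 * L * inner (e + d) (e + d)
    + (2 * L)^-1 * inner (l + L *: (U *m (e + d))) (l + L *: (U *m (e + d)))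
  = 2 * L * inner e e + (2 * L)^-1 * inner l l
    - inner h (e + d) - 2 * L * inner d d
    + L / 2 * inner (U *m d) (U *m d) - L / 2 * gain.
Proof.
(* Pairing [d_eq] with [e + d] produces [inner l (U *m (e + d))], which cancels the cross term of
   the dual square. *)
have key : 4 * L * inner d (e + d) = - (inner h (e + d) + inner l (U *m (e + d))
    + L * inner (U *m e) (U *m (e + d))).
  rewrite {1}d_eq innerZl !innerDl innerZl (inner_mulmxl U l)
    (inner_mulmxl U (U *m e)) Usym.
  by field; rewrite gt_eqF.
move: key; rewrite /gain mulmxDr !innerE (innerC d e) (innerC (U *m d) l).
rewrite (innerC (U *m d) (U *m e)) (innerC (U *m e) l) => key.
move/eqP: key; rewrite -subr_eq0 => /eqP key.
apply/eqP; rewrite -subr_eq0; apply/eqP; apply: etrans key.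
by field; rewrite gt_eqF.
Qed.

Hypothesis U_le1 : forall X : 'M[R]_(m, n), inner (U *m X) (U *m X) <= inner X X.

Lemma dual_residual_le :
  inner (U *m l) (U *m l) <= 32 * L ^+ 2 * inner d d + 4 * inner h h + 4 * L ^+ 2 * gain.
Proof.
have -> : U *m l = - (4 * L) *: d - h - L *: (U *m (U *m e)).
  rewrite d_eq scalerA mulrNN mulfV ?scale1r ?gt_eqF ?mulr_gt0 //.
  by rewrite [h + U *m l]addrC [_ + h + _]addrAC !addrK.
(* The summand 4 L d takes the weight 2, whence 32 = 2 * 4^2. *)
apply: le_trans (inner_sum3_le _ _ _) _.
rewrite !innerE.
have := ler_wpM2l (sqr_ge0 L) (U_le1 (U *m e)); rewrite -/gain; nra.
Qed.

Variables (mu s : R).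
Hypotheses (mu_gt0 : 0 < mu) (s_gt0 : 0 < s).
Hypothesis h_ge :
  mu / 4 * inner e e + (4 * L)^-1 * inner h h - L / 2 * inner d d <= inner h (e + d).
Hypothesis l_le : s * inner l l <= 2 * inner (U *m l) (U *m l).

Lemma lyapunov_contraction :
  2 * L * inner (e + d) (e + d)
    + (2 * L)^-1 * inner (l + L *: (U *m (e + d))) (l + L *: (U *m (e + d)))
  <= (1 - 1 / (39 * (L / mu + 1 / s))) * (2 * L * inner e e + (2 * L)^-1 * inner l l).
Proof.
rewrite lyapunov_identity; set delta := 1 / _.
have den_gt0 : 0 < 39 * (L / mu + 1 / s) by rewrite mulr_gt0 ?addr_gt0 ?divr_gt0.
have delta_mu : delta * L <= mu / 39.
  rewrite /delta mulrAC [1 * L]mul1r ler_pdivrMr //.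
  have -> : mu / 39 * (39 * (L / mu + 1 / s)) = L + mu / s.
    by field; rewrite !gt_eqF.
  by rewrite lerDl divr_ge0 ?ltW.
have delta_s : delta <= s / 39.
  rewrite /delta ler_pdivrMr //.
  have -> : s / 39 * (39 * (L / mu + 1 / s)) = 1 + s * (L / mu).
    by field; rewrite !gt_eqF.
  by rewrite lerDl mulr_ge0 ?divr_ge0 ?ltW.
have primal : delta * (2 * L * inner e e) <= mu / 4 * inner e e.
  have := ler_wpM2r (inner_ge0 e) delta_mu.
  have : 0 <= mu * inner e e by rewrite mulr_ge0 ?inner_ge0 ?ltW.
  lra.
(* The right side is the decrease left besides the [mu / 4] term, after [h_ge] and [U_le1] have used
   up L |d|^2. The tightest demand on the constant 39 comes from [inner d d]: 2 * 32 / 39 <= 2. *)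
have dual : delta * ((2 * L)^-1 * inner l l) <=
    L * inner d d + (4 * L)^-1 * inner h h + L / 2 * gain.
  have il0 := inner_ge0 l; have id0 := inner_ge0 d; have ih0 := inner_ge0 h.
  have ig0 : 0 <= gain := inner_ge0 _.
  have step1 : 39 * (delta * inner l l) <= 2 * inner (U *m l) (U *m l).
    by apply: le_trans l_le; have := ler_wpM2r il0 delta_s; lra.
  have step2 := le_trans step1 (ler_wpM2l (ler0n _ 2) dual_residual_le).
  rewrite -(ler_pM2l (_ : 0 < 2 * L)) ?mulr_gt0 //.
  have -> : 2 * L * (delta * ((2 * L)^-1 * inner l l)) = delta * inner l l.
    by field; rewrite gt_eqF.
  have -> : 2 * L * (L * inner d d + (4 * L)^-1 * inner h h + L / 2 * gain)
      = 2 * (L ^+ 2 * inner d d) + inner h h / 2 + L ^+ 2 * gain.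
    by field; rewrite gt_eqF.
  have := mulr_ge0 (sqr_ge0 L) id0; have := mulr_ge0 (sqr_ge0 L) ig0; lra.
have contr := ler_wpM2l (ltW L_gt0) (U_le1 d).
rewrite mulrBl mul1r (mulrDr delta); move: h_ge primal dual contr.
by move: (4 * L)^-1 (2 * L)^-1 => q r; clearbody delta; lra.
Qed.

End Step.

(** * Singular values and the spectrum of a real symmetric matrix *)

Local Open Scope sesquilinear_scope.

(** If the second entry were below [t], only the head of the nonincreasing list could reach [t]. A
    count above 1 also rules out the default value of the lookup. *)
Lemma le_nth1_of_count (R : realType) (t : R) (s : seq R) :
  sorted >=%R s -> (1 < count (>= t)%R s)%N -> t <= s`_1.
Proof.
case: s => [|a [|b s]] //=; first by case: (t <= a).
move=> /andP[_ hs] hc; rewrite leNgt; apply/negP => ltb.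
have /allP hall := order_path_min (rev_trans le_trans) hs.
have h0 : count (>= t)%R s = 0%N.
  apply/eqP; rewrite -leqn0 leqNgt -has_count; apply/hasPn => y /hall /= yb.
  by rewrite -ltNge (le_lt_trans yb).
by move: hc; rewrite h0 (leNgt t b) ltb /= addn0; case: (t <= a).
Qed.

Lemma sorted_singular_values (R : realType) (m : nat) (A : 'M[R]_m) :
  sorted >=%R (singular_values A).
Proof.
rewrite /singular_values; set p := char_poly _.
rewrite rev_sorted sorted_pairwise; last exact: le_trans.
have : sorted <%R (rootsR p) by rewrite /rootsR sorted_roots.
rewrite lt_sorted_pairwise.
elim: (rootsR p) => //= a s IH /andP[ha hs].
rewrite pairwise_cat IH // andbT; apply/andP; split; last first.
  by apply/(pairwiseP 0) => i j; rewrite !inE size_nseq => hi hj _; rewrite !nth_nseq hi hj.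
apply/allrelP => y z; rewrite mem_nseq => /andP[_ /eqP ->] /flattenP [l /mapP [b bs ->]].
rewrite mem_nseq => /andP[_ /eqP ->]; apply: ler_wsqrtr.
by move/allP: ha => /(_ b bs) /ltW.
Qed.

Lemma count_singular_values (R : realType) (m : nat) (A : 'M[R]_m) (P : pred R) :
  count P (singular_values A) =
  (\sum_(a <- rootsR (char_poly (A^T *m A))) mup a (char_poly (A^T *m A)) * P (Num.sqrt a))%N.
Proof.
rewrite /singular_values count_rev count_flatten sumnE !big_map.
by apply: eq_bigr => a _; rewrite count_nseq mulnC.
Qed.

(** Divisibility by the product covers two distinct roots and a double root alike: when [a = b] the
    multiplicity is at least 2, so this root alone fills two places of the list. *)
Lemma le_sigma2 (R : realType) (m : nat) (A : 'M[R]_m) (t a b : R) :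
  ('X - a%:P) * ('X - b%:P) %| char_poly (A^T *m A) ->
  t <= Num.sqrt a -> t <= Num.sqrt b -> t <= sigma2 A.
Proof.
set p := char_poly _ => hdvd ta tb.
have p0 : p != 0 by rewrite monic_neq0 ?char_poly_monic.
have uroots : uniq (rootsR p).
  by apply: (@sorted_uniq _ <%R lt_trans ltxx); rewrite /rootsR sorted_roots.
have memr c : ('X - c%:P) %| p -> c \in rootsR p.
  by rewrite dvdp_XsubCl -(roots_on_rootsR p0) in_itv.
have da : ('X - a%:P) %| p by apply: dvdp_trans hdvd; apply: dvdp_mulr.
have db : ('X - b%:P) %| p by apply: dvdp_trans hdvd; apply: dvdp_mull.
rewrite /sigma2; apply: le_nth1_of_count (sorted_singular_values _ _ _) _; rewrite count_singular_values -/p.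
rewrite (bigD1_seq a) ?memr //= ta muln1.
have [eab|nab] := eqVneq a b.
  apply: leq_trans (leq_addr _ _); rewrite mup_geq //.
  by move: hdvd; rewrite -eab -expr2.
have ba : b != a by rewrite eq_sym.
rewrite (big_rem b) ?memr //= ba tb muln1 addnA.
by apply: leq_trans (leq_addr _ _); apply: (@leq_add 1 1); rewrite -XsubC_dvd.
Qed.

Lemma char_poly_similar (F : comUnitRingType) (m : nat) (P A : 'M[F]_m) :
  P \in unitmx -> char_poly (invmx P *m A *m P) = char_poly A.
Proof.
move=> uP; rewrite /char_poly.
have PVP : map_mx polyC (invmx P) *m map_mx polyC P = 1%:M.
  by rewrite -map_mxM mulVmx // map_mx1.
have -> : char_poly_mx (invmx P *m A *m P) =
    map_mx polyC (invmx P) *m char_poly_mx A *m map_mx polyC P.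
  rewrite /char_poly_mx mulmxBr mulmxBl !map_mxM; congr (_ - _).
  by rewrite scalar_mxC -mulmxA PVP mulmx1.
by rewrite !det_mulmx mulrAC -det_mulmx PVP det1 mul1r.
Qed.

Local Notation toC := (real_complex _).

(** A hermitian matrix has real spectrum, so the diagonal descends to [R] although the unitary
    change of basis lives over [R[i]]. *)
Lemma real_symmetric_spectral (R : realType) (m : nat) (W : 'M[R]_m) :
  W^T = W ->
  exists (P : 'M[R[i]]_m) (d : 'rV[R]_m), P \is unitarymx /\
    map_mx toC W = invmx P *m diag_mx (map_mx toC d) *m P.
Proof.
move=> Wsym; pose A := map_mx toC W.
have Ah : A \is hermsymmx.
  apply: realsym_hermsym.
    by apply/is_hermitianmxP; rewrite expr0 scale1r map_mx_id // /A -{1}Wsym map_trmx.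
  by apply/mxOverP => i j; rewrite mxE complex_real.
exists (spectralmx A), (map_mx (@complex.Re R) (spectral_diag A)).
split; first exact: spectral_unitarymx.
rewrite -[LHS]/A.
have -> : map_mx toC (map_mx (@complex.Re R) (spectral_diag A)) = spectral_diag A.
  apply/matrixP => i j; rewrite !mxE RRe_real //.
  exact: (mxOverP (hermitian_spectral_diag_real Ah)).
exact/orthomx_spectralP/hermitian_normalmx.
Qed.

(** In an eigenbasis [e] occupies a single coordinate, since [sigma2 W < 1] makes the eigenvalue 1
    simple. Orthogonality removes that coordinate from [u], and the other eigenvalues are at most
    [sigma2 W]. *)
Lemma rayleigh_le_sigma2 (R : realType) (m : nat) (W : 'M[R]_m)
    (e u : 'rV[R]_m) :
  W^T = W -> sigma2 W < 1 -> e != 0 -> e *m W = e -> u *m e^T = 0 ->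
  (u *m W *m u^T) 0 0 <= sigma2 W * (u *m u^T) 0 0.
Proof.
move=> Wsym s1 e0 eW ue.
have [P [d [Pu WE]]] := real_symmetric_spectral _ _ _ Wsym.
have uP := unitarymx_unit Pu.
pose D := diag_mx (map_mx toC d).
have charW : char_poly (W^T *m W) = \prod_(i < m) ('X - (d 0 i ^+ 2)%:P).
  apply: (map_poly_inj toC); rewrite map_char_poly map_mxM Wsym WE.
  have -> : invmx P *m D *m P *m (invmx P *m D *m P) = invmx P *m (D *m D) *m P.
    by rewrite !mulmxA mulmxK.
  rewrite char_poly_similar // /D mulmx_diag char_poly_trig ?diag_mx_is_trig //.
  rewrite rmorph_prod /=; apply: eq_bigr => i _.
  by rewrite !mxE eqxx mulr1n rmorphB /= map_polyX map_polyC /= rmorphXn.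
(* [c w] holds the coordinates of [w] in the eigenbasis: by [quad] they preserve inner products, and
   by [cW] the matrix [W] acts on them diagonally. *)
pose c (w : 'rV[R]_m) := map_mx toC w *m invmx P.
have cE w : map_mx toC w = c w *m P by rewrite mulmxKV.
have quad w1 w2 : c w1 *m (c w2)^t* = map_mx toC (w1 *m w2^T).
  rewrite map_mxM [in RHS]cE -mulmxA; congr (_ *m _).
  rewrite /c invmx_unitary // trmx_mul map_mxM trmxCK; congr (_ *m _).
  by apply/matrixP => i j; rewrite !mxE; apply: conj_Creal; rewrite complex_real.
have cW w : c (w *m W) = c w *m D.
  by rewrite /c map_mxM WE -/D !mulmxA mulmxK.
clearbody c.
have [i0 ci0] : exists i, c e 0 i != 0.
  apply/existsP; apply: contraNT e0; rewrite negb_exists => /forallP h.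
  have c0 : c e = 0 by apply/rowP => i; have := h i; rewrite negbK [RHS]mxE => /eqP.
  apply/eqP/(map_mx_inj (f := toC)); rewrite map_mx0 cE c0 mul0mx //.
have ceD i : c e 0 i * toC (d 0 i) = c e 0 i.
  have /rowP /(_ i) := cW e; rewrite eW mul_mx_diag !mxE => h.
  by rewrite [RHS]h.
have d1 i : c e 0 i != 0 -> d 0 i = 1.
  move=> ci; apply: (@complexI R); apply: (mulfI ci); rewrite ceD rmorph1 mulr1 //.
(* The roots 1 and [d 0 i ^+ 2] bound [sigma2 W] below by the smaller of 1 and the modulus of
   [d 0 i]; a modulus above 1 would contradict [s1]. *)
have hd i : i != i0 -> `|d 0 i| <= sigma2 W.
  move=> ii0.
  have hdvd : ('X - (d 0 i0 ^+ 2)%:P) * ('X - (d 0 i ^+ 2)%:P) %| char_poly (W^T *m W).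
    by rewrite charW (bigD1 i0) //= (bigD1 i) //= mulrA dvdp_mulIl.
  have [dle|dgt] := leP `|d 0 i| 1.
    by apply: le_sigma2 hdvd _ _; rewrite sqrtr_sqr // (d1 i0) // normr1.
  suff : 1 <= sigma2 W by rewrite leNgt s1.
  by apply: le_sigma2 hdvd _ _; rewrite sqrtr_sqr ?(ltW dgt) // (d1 i0) // normr1.
have ce0 i : i != i0 -> c e 0 i = 0.
  move=> ii0; apply/eqP; apply: contraT => /d1 di.
  by have := hd i ii0; rewrite di normr1 leNgt s1.
have cu0 : c u 0 i0 = 0.
  have := quad u e; rewrite ue map_mx0 => /matrixP /(_ 0 0).
  rewrite !mxE (bigD1 i0) //= big1 ?addr0; last first.
    by move=> i ii0; rewrite !mxE ce0 // rmorph0 mulr0.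
  by rewrite !mxE => /eqP; rewrite mulf_eq0 conjC_eq0 (negPf ci0) orbF => /eqP.
rewrite -lecR rmorphM /=.
have -> : toC ((u *m W *m u^T) 0 0) = \sum_i toC (d 0 i) * `|c u 0 i| ^+ 2.
  have /matrixP /(_ 0 0) := quad (u *m W) u; rewrite cW [in RHS]mxE => <-.
  rewrite mul_mx_diag mxE; apply: eq_bigr => i _.
  by rewrite !mxE normCK -mulrA mulrCA.
have -> : toC ((u *m u^T) 0 0) = \sum_i `|c u 0 i| ^+ 2.
  have /matrixP /(_ 0 0) := quad u u; rewrite [in RHS]mxE => <-.
  by rewrite mxE; apply: eq_bigr => i _; rewrite !mxE normCK.
rewrite mulr_sumr; apply: ler_sum => i _.
have [->|ii0] := eqVneq i i0; first by rewrite cu0 normr0 expr0n !mulr0.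
apply: ler_wpM2r; first by rewrite exprn_ge0.
by rewrite lecR (le_trans (ler_norm _)) // hd.
Qed.

Local Close Scope sesquilinear_scope.

(** * The square root [U]: norm bound, kernel and spectral gap *)

Lemma sqrt_contraction {R : realType} {m n : nat} (W U : 'M[R]_m) (X : 'M[R]_(m, n)) :
  is_psd_sqrt U (2^-1 *: (1%:M - W)) -> loewner_le (- 1%:M) W ->
  inner (U *m X) (U *m X) <= inner X X.
Proof.
(* Since U^2 = (I - W) / 2, the two sides differ by <X, (I + W) X> / 2. *)
move=> [[Usym _] UU] /(inner_psd _ X); rewrite inner_mulmxl Usym mulmxA UU.
rewrite -scalemxAl !mulmxBl mul1mx mulNmx mul1mx innerZr !innerE; lra.
Qed.

Lemma mul_sqrt_const1 {R : realType} {m : nat} (W U : 'M[R]_m) :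
  is_psd_sqrt U (2^-1 *: (1%:M - W)) -> W *m const_mx 1 = const_mx 1 :> 'cV[R]_m ->
  U *m const_mx 1 = 0 :> 'cV[R]_m.
Proof.
move=> [[Usym _] UU] W1; apply/inner_eq0; rewrite inner_mulmxl Usym mulmxA UU.
by rewrite -scalemxAl mulmxBl mul1mx W1 subrr scaler0 -(scale0r 0) innerZr mul0r.
Qed.

(** Here 2 |U X|^2 = |X|^2 - <X, W X>, and the Rayleigh bound applies column by column: each column
    is orthogonal to the all-ones vector because the symmetric [U] kills that vector. *)
Lemma spectral_gap {R : realType} {m n : nat} (W U : 'M[R]_m.+1) (X : 'M[R]_(m.+1, n)) :
  is_psd_sqrt U (2^-1 *: (1%:M - W)) -> W = W^T ->
  W *m const_mx 1 = const_mx 1 :> 'cV[R]_m.+1 -> sigma2 W < 1 -> in_span X U ->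
  (1 - sigma2 W) * inner X X <= 2 * inner (U *m X) (U *m X).
Proof.
move=> hU Wsym W1 s1 /submxP [Y XE]; have [[Usym _] UU] := hU.
have -> : 2 * inner (U *m X) (U *m X) = inner X X - inner X (W *m X).
  rewrite inner_mulmxl Usym mulmxA UU -scalemxAl mulmxBl mul1mx innerZr !innerE.
  by rewrite mulrA divff ?mul1r // pnatr_eq0.
rewrite mulrBl mul1r lerD2l lerN2 !inner_cols mulr_sumr; apply: ler_sum => j _.
rewrite [col j (W *m X)]colE -mulmxA -colE mulmxA -[X in _ *m X]trmxK.
rewrite -[X in _ <= _ * (_ *m X) _ _]trmxK.
apply: (rayleigh_le_sigma2 _ _ _ (const_mx 1)) => //.
- by apply/eqP => /matrixP /(_ 0 0) /eqP; rewrite !mxE oner_eq0.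
- by rewrite -[LHS]trmxK trmx_mul -Wsym trmx_const W1 trmx_const.
- by rewrite trmx_const tr_col XE row_mul -mulmxA Usym (mul_sqrt_const1 W U) // mulmx0.
Qed.

(** * The stacked objective and its convexity and smoothness constants *)

Lemma inner_stack {R : realType} {m n : nat} (f : 'I_m -> 'rV[R]_n -> R)
    (x y : 'M[R]_(m, n)) :
  inner (stacked_grad f x) y = \sum_i inner (grad (f i) (row i x)) (row i y).
Proof. by rewrite inner_rows; apply: eq_bigr => i _; rewrite rowK. Qed.

Lemma strongly_convex_stack {R : realType} {m n : nat} (f : 'I_m -> 'rV[R]_n -> R)
    (mu : R) (x y : 'M[R]_(m, n)) :
  (forall i, strongly_convex mu (f i)) ->
  \sum_i f i (row i y) >= \sum_i f i (row i x) + inner (stacked_grad f x) (y - x)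
    + mu / 2 * fnorm (y - x) ^+ 2.
Proof.
move=> hf; rewrite fnorm_sqr inner_stack (inner_rows (y - x)) mulr_sumr -!big_split.
apply: ler_sum => i _ /=; rewrite linearB /= -fnorm_sqr; exact: hf.
Qed.

Lemma smooth_stack {R : realType} {m n : nat} (f : 'I_m -> 'rV[R]_n -> R)
    (L : R) (x y : 'M[R]_(m, n)) :
  (forall i, smooth L (f i)) ->
  \sum_i f i (row i y) <= \sum_i f i (row i x) + inner (stacked_grad f x) (y - x)
    + L / 2 * fnorm (y - x) ^+ 2.
Proof.
move=> hf; rewrite fnorm_sqr inner_stack (inner_rows (y - x)) mulr_sumr -!big_split.
apply: ler_sum => i _ /=; rewrite linearB /= -fnorm_sqr; exact: hf.
Qed.

(** Yields [0 < L] in the theorem. The dimension [n.+1] makes the two test points distinct. *)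
Lemma strongly_convex_smooth_le {R : realType} {n : nat} (g : 'rV[R]_n.+1 -> R) (mu L : R) :
  strongly_convex mu g -> smooth L g -> mu <= L.
Proof.
move=> /(_ 0 (const_mx 1)) h1 /(_ 0 (const_mx 1)) h2.
have := le_trans h1 h2; rewrite lerD2l ler_pM2r ?ler_pM2r ?invr_gt0 ?ltr0n //.
rewrite subr0 fnorm_sqr lt_def inner_ge0 andbT; apply/eqP => /inner_eq0.
by move=> /matrixP /(_ 0 0) /eqP; rewrite !mxE oner_eq0.
Qed.

Lemma in_span_mul {R : realType} {m p q : nat} (A : 'M[R]_(m, q)) (X : 'M[R]_(m, p)) :
  in_span X A -> exists Y, X = A *m Y.
Proof. by move=> /submxP [Y XE]; exists Y^T; rewrite -[X]trmxK XE trmx_mul trmxK. Qed.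

Theorem theorem1 (R : realType) (m n : nat)
    (f : 'I_m -> 'rV[R]_n -> R) (mu L : R)
    (f_diff : forall (i : 'I_m) (x : 'rV[R]_n), differentiable (f i) x)
    (mu_gt0 : 0 < mu)
    (f_convex : forall i : 'I_m, strongly_convex mu (f i))
    (f_smooth : forall i : 'I_m, smooth L (f i))
    (neighbor : rel 'I_m)
    (neighbor_sym : symmetric neighbor)
    (neighbor_irr : irreflexive neighbor)
    (W : 'M[R]_m) (hW : weight_matrix neighbor W)
    (U : 'M[R]_m) (hU : is_psd_sqrt U (2^-1 *: (1%:M - W)))
    (alpha beta : R)
    (hbeta : beta = L) (halpha : alpha = 1 / (2 * (L + beta)))
    (x v : nat -> 'M[R]_(m, n))
    (hv0 : in_span (v 0%N) (U *m U))
    (hxv : extra_iterates f W alpha beta x v)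
    (lambda : nat -> 'M[R]_(m, n))
    (hlambda : forall k : nat, in_span (lambda k) U /\ U *m lambda k = v k)
    (xstar : 'rV[R]_n) (hxstar : is_minimizer (average f) xstar)
    (lambdastar : 'M[R]_(m, n)) (hlambdastar : in_span lambdastar U)
    (hkkt : is_kkt f U (consensus m xstar) lambdastar) :
  let rho (k : nat) : R :=
    (L + beta) * fnorm (x k - consensus m xstar) ^+ 2
    + 1 / (2 * beta) * fnorm (lambda k - lambdastar) ^+ 2 in
  let delta : R := 1 / (39 * (L / mu + 1 / (1 - sigma2 W))) in
  forall k : nat, rho k.+1 <= (1 - delta) * rho k.
Proof.
move=> rho delta k; rewrite {}/rho {}/delta !fnorm_sqr.
(* If [m] or [n] is 0, all norms are empty sums and both sides vanish. *)
case: m => [|m'] in f f_diff f_convex f_smooth neighbor neighbor_sym neighbor_irr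
  W hW U hU x v hv0 hxv lambda hlambda hxstar lambdastar hlambdastar hkkt *.
  by rewrite /inner !big_ord0 !mulr0 addr0 mulr0.
case: n => [|n'] in f f_diff f_convex f_smooth x v hv0 hxv lambda hlambda
  xstar hxstar lambdastar hlambdastar hkkt *.
  by rewrite /inner !big1 ?mulr0 ?addr0 ?mulr0 // => i _; rewrite big_ord0.
have L_gt0 : 0 < L.
  exact: lt_le_trans mu_gt0 (strongly_convex_smooth_le _ _ _ (f_convex ord0) (f_smooth ord0)).
have [Usym _] := hU.1; have UU := hU.2.
have [Wsupp Wsym Wle Wge W1 s1] := hW.
set xs := consensus _ _ in hkkt *; have [gs Uxs] := hkkt.
set s := lambdastar in hlambdastar hkkt gs *.
pose d := x k.+1 - x k.
have eE : x k.+1 - xs = (x k - xs) + d by rewrite /d [RHS]addrC subrKA.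
have UE y : U *m (y - xs) = U *m y by rewrite mulmxBr Uxs subr0.
have half : (L / 2) *: (1%:M - W) = L *: (U *m U) by rewrite UU scalerA.
have [xE vE] := hxv k.
have [lk Ulk] := hlambda k; have [lk1 Ulk1] := hlambda k.+1.
(* Only the recursion for [v] is given. The defect [z] of the recursion for [lambda] is in the range
   of the symmetric [U] and is killed by [U], so its inner product with itself is 0. *)
have lE : lambda k.+1 - s = (lambda k - s) + L *: (U *m (x k - xs + d)).
  rewrite -eE UE addrAC; congr (_ + _); apply/eqP; rewrite -subr_eq0; apply/eqP.
  have [Y1 Y1E] := in_span_mul _ _ lk; have [Y2 Y2E] := in_span_mul _ _ lk1.
  set z := _ - _; have zE : z = U *m (Y2 - (Y1 + L *: x k.+1)).
    by rewrite mulmxBr mulmxDr -scalemxAr -Y1E -Y2E.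
  apply/inner_eq0; rewrite {1}zE inner_mulmxl Usym /z mulmxBr mulmxDr Ulk Ulk1.
  rewrite vE hbeta scalemxAl half -scalemxAl -scalemxAr mulmxA subrr.
  by rewrite -(scale0r 0) innerZr mul0r.
rewrite lE eE hbeta.
have -> : L + L = 2 * L by rewrite mulr_natl mulr2n.
have -> : 1 / (2 * L) = (2 * L)^-1 by rewrite div1r.
apply: (lyapunov_contraction _ _ _ _ _ (stacked_grad f (x k) - stacked_grad f xs))
  => //.
- rewrite /d {1}xE addrC addKr halpha hbeta -scaleNr; congr (_ *: _).
    by rewrite div1r; congr (- _^-1); ring.
  rewrite scalemxAl half UE -scalemxAl -mulmxA; congr (_ + _).
  (* By the KKT condition [U *m s] is minus the gradient at [xs], so the two gradients at [xs]
     cancel. *)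
  by rewrite mulmxBr Ulk -(addr0_eq gs) opprK [v k + _]addrC subrKA.
- by move=> X; apply: sqrt_contraction hU Wge.
- by rewrite subr_gt0.
- rewrite -eE -!fnorm_sqr.
  have := @grad_inner_ge R _ _ (fun y => \sum_i f i (row i y)) (stacked_grad f)
    mu L (ltW mu_gt0) L_gt0 _ _ (x k) xs (x k.+1).
  by apply => y z; [apply: strongly_convex_stack | apply: smooth_stack].
- apply: spectral_gap => //; rewrite /in_span.
  by rewrite linearB /= addmx_sub // eqmx_opp.
Qed.
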